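(* There is a deterministic algorithm in the synchronous multi-port message-passing model with crash failures that, for all $n$ and $t$ with $t<\frac n5$, solves gossiping in $\mathcal{O}(\log n\log t)$ rounds with nodes sending $\mathcal{O}(n+t\log n\log t)$ messages in total.
   Context: Model: $n$ nodes with distinct names in $\{1,\dots,n\}$; $n$ and an upper bound $t$ on the number of crashes are known to all nodes. Computation proceeds in synchronous rounds starting simultaneously; in a round any node may send messages (of arbitrary size) to any set of other nodes, and all messages sent in a round are delivered in that round. An adversary may crash up to $t$ nodes at times of its choosing; a crashed node performs no further activity. A node that halts without crashing is non-faulty. Running time is the number of rounds until all non-faulty nodes have halted; communication is the number of messages. Gossiping: each node $i$ has an input value (its rumor); each node that does not crash must eventually halt and decide on an extant set, a set of pairs (node name, that node's rumor), such that (1) if a node $j$ crashed before sending any message then $j$'s pair is in no decided extant set, and (2) if a node $j$ halted without crashing then $j$'s pair belongs to every decided extant set. Decided extant sets need not be equal. *)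

(* Defs.v *)
From HB Require Import structures.
From mathcomp Require Import all_boot all_order all_algebra finmap.
From mathcomp Require Import reals exp.

Set Implicit Arguments.
Unset Strict Implicit.
Unset Printing Implicit Defensive.

Import Order.TTheory GRing.Theory Num.Theory.
Local Open Scope ring_scope.

(* The deterministic program run by n nodes, with names 'I_n and rumors in V.
   Local computation and message contents are unrestricted.  [send s j] is the
   message, if any, addressed to j; [receive s m] is the state after a round
   in which [m j] is the message, if any, received from j.  A node halts as
   soon as [decision] is defined, and decides on that extant set. *)
Record protocol (n : nat) (V : choiceType) := Protocol {
  state : Type;
  message : Type;
  init : 'I_n -> V -> state;
  send : state -> 'I_n -> option message;
  receive : state -> ('I_n -> option message) -> state;
  decision : state -> option {fset 'I_n * V}
}.

(* The nodes know n and the bound t on the number of crashes. *)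
Definition gossip_algorithm := forall (n t : nat) (V : choiceType), protocol n V.

(* [crash i = Some (r, B)]: node i is to crash during round r, after its
   messages of that round addressed to nodes in B have been sent, and no
   others.  Since protocols are deterministic, quantifying over all schedules
   accounts for adaptive adversaries. *)
Definition crash_schedule (n : nat) := 'I_n -> option (nat * {set 'I_n}).

Definition at_most_crashes (n t : nat) (crash : crash_schedule n) : Prop :=
  (#|[set i | isSome (crash i)]| <= t)%N.

Section Execution.
Variables (n : nat) (V : choiceType) (P : protocol n V).

Inductive status :=
  | Active of state P
  | Halted of {fset 'I_n * V}
  | Crashed.

Definition settle (s : state P) : status :=
  if decision s is Some D then Halted D else Active s.

Variables (rumor : 'I_n -> V) (crash : crash_schedule n).

Definition crashes_in (r : nat) (i : 'I_n) : bool :=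
  if crash i is Some (r', _) then r' == r else false.

Definition suppressed (r : nat) (i j : 'I_n) : bool :=
  if crash i is Some (r', B) then (r' == r) && (j \notin B) else false.

(* Messages go to other nodes only, so a message to oneself is ignored. *)
Definition outgoing (r : nat) (c : 'I_n -> status) (i j : 'I_n) :
    option (message P) :=
  if c i is Active s then
    if (j == i) || suppressed r i j then None else send s j
  else None.

Definition next (r : nat) (c : 'I_n -> status) (i : 'I_n) : status :=
  if c i is Active s then
    if crashes_in r i then Crashed
    else settle (receive s (fun j => outgoing r c j i))
  else c i.

(* The situation after the first r rounds, which are numbered from 0. *)
Fixpoint config (r : nat) : 'I_n -> status :=
  if r is r'.+1 then next r' (config r')
  else fun i => settle (init P i (rumor i)).

Definition sends (r : nat) (i j : 'I_n) : bool :=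
  isSome (outgoing r (config r) i j).

Definition messages_sent (T : nat) : nat :=
  (\sum_(r < T) #|[set p : 'I_n * 'I_n | sends r p.1 p.2]|)%N.

Definition node_crashes (i : 'I_n) : Prop := exists r, config r i = Crashed.

Definition node_decides (i : 'I_n) (D : {fset 'I_n * V}) : Prop :=
  exists r, config r i = Halted D.

Definition halted_by (T : nat) (i : 'I_n) : Prop :=
  exists D, config T i = Halted D.

Definition gossiping : Prop :=
  [/\ (forall i, ~ node_crashes i -> exists D, node_decides i D),
      (forall i D, node_decides i D -> forall p, p \in D -> p.2 = rumor p.1),
      (forall j, node_crashes j -> (forall r k, ~~ sends r j k) ->
         forall i D, node_decides i D -> (j, rumor j) \notin D)
    & (forall j, (exists D, node_decides j D) ->
         forall i D, node_decides i D -> (j, rumor j) \in D)].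

End Execution.

Definition solves_gossiping (n t : nat) (V : choiceType) (P : protocol n V) :
    Prop :=
  forall (rumor : 'I_n -> V) (crash : crash_schedule n),
    at_most_crashes t crash -> gossiping P rumor crash.

Definition running_time_le (R : realType) (n t : nat) (V : choiceType)
    (P : protocol n V) (b : R) : Prop :=
  forall (rumor : 'I_n -> V) (crash : crash_schedule n),
    at_most_crashes t crash ->
    exists T : nat, T%:R <= b /\
      forall i, ~ node_crashes P rumor crash i -> halted_by P rumor crash T i.

Definition messages_le (R : realType) (n t : nat) (V : choiceType)
    (P : protocol n V) (b : R) : Prop :=
  forall (rumor : 'I_n -> V) (crash : crash_schedule n),
    at_most_crashes t crash ->
    forall T : nat, (messages_sent P rumor crash T)%:R <= b.

(* Logarithms inside asymptotic bounds are at least 1; otherwise the bound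
   log n log t would be zero or undefined for t <= 1. *)
Definition log1 (R : realType) (m : nat) : R := Num.max 1 (ln m%:R).

(* Main.v *)
Require Import Defs.
From HB Require Import structures.
From mathcomp Require Import all_boot all_order all_algebra finmap.
From mathcomp Require Import zify ring.
From mathcomp Require Import boolp reals exp.

Set Implicit Arguments.
Unset Strict Implicit.
Unset Printing Implicit Defensive.

(** Let [L] be the first [m = 5 t + 1] nodes.  A counting argument yields a
    graph [E] on [L] with [O(m)] edges in which any two sets of at least [m / 8]
    nodes are joined; whatever the at most [t] crashes, it contains a core [Q]
    of more than [m / 2] correct nodes with diameter [D = O(log t)].  It also
    yields, for each [i], a bipartite graph [G i] of degree [O(2 ^ i)] from all
    nodes to [L] such that [O((m + n / 2 ^ (2 ^ i)) / 2 ^ i)] nodes have no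
    neighbour in [Q].

    In phase [i] every node not yet served sends its rumor to its [G i]
    neighbours; then [L] floods everything it knows along [E] for [2 D] rounds,
    including who has heard of whom; finally a node of [L] acknowledges the
    requests that it knows a majority of [L] to have heard of.  A majority meets
    [Q], so an acknowledged rumor is safe, and members of [Q] do acknowledge.
    Hence phase [i + 1] costs [O(m + n / 2 ^ (2 ^ i))] requests, and after
    [O(log n)] phases everybody is served.  After a first run of the phases all
    of [Q] knows every surviving rumor.  In a second run a majority of [L] having
    heard of the new request implies that a member of [Q] did so after the first
    run, and since knowledge travels along with such facts, the node served then
    knows every surviving rumor. *)

(** * Sampling graphs *)

Lemma leq_expn2r (m n e : nat) : m <= n -> m ^ e <= n ^ e.
Proof. by case: e => [|e] // le_mn; rewrite leq_exp2r. Qed.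

Lemma leq_sum_nat (a b : nat) (F1 F2 : nat -> nat) :
  (forall i, a <= i < b -> F1 i <= F2 i) ->
  \sum_(a <= i < b) F1 i <= \sum_(a <= i < b) F2 i.
Proof. by move=> le12; rewrite [leqLHS]big_nat [leqRHS]big_nat leq_sum. Qed.

Lemma card_ltn_ord (n m : nat) : #|[set q : 'I_n | q < m]| = minn n m.
Proof.
have [le_mn|le_nm] := leqP m n.
  rewrite -sum1_card (eq_bigl (fun q : 'I_n => q < m)) => [|q]; last by rewrite inE.
  by rewrite -(big_ord_widen n (fun _ => 1) le_mn) sum1_card card_ord.
rewrite -[RHS]card_ord -cardsT; apply: eq_card => q; rewrite !inE.
exact: ltn_trans (ltn_ord q) le_nm.
Qed.

(** Bernoulli's inequality over the integers: [(1 + 1 / N) ^ h <= 1 / (1 - h / N)]. *)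
Lemma leq_succ_expn_mul (N h : nat) : h <= N -> N.+1 ^ h * (N - h) <= N ^ h.+1.
Proof.
elim: h => [|h IHh] hN; first by rewrite expn0 mul1n subn0 expn1.
rewrite expnS -mulnA mulnCA.
have step : N.+1 * (N - h.+1) <= (N - h) * N by nia.
apply: leq_trans (leq_mul (leqnn _) step) _.
by rewrite mulnA (expnS N h.+1) mulnC leq_mul2l IHh ?orbT // ltnW.
Qed.

(** At half the exponent Bernoulli's inequality costs a factor 2, and squaring turns it into 4. *)
Lemma succ_expn_double (h : nat) : (h.*2).+1 ^ h.*2 <= 4 * h.*2 ^ h.*2.
Proof.
case: h => [|h] //; set N := h.+1.*2.
have half : N.+1 ^ h.+1 <= 2 * N ^ h.+1.
  have := @leq_succ_expn_mul N h.+1; rewrite /N -addnn leq_addr addnK => /(_ isT).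
  by rewrite (expnS _ h.+1) addnn -muln2 -mulnA mulnC leq_pmul2l.
rewrite {2 4}/N -muln2 !expnM -(expnMn 2 _ 2).
by rewrite leq_exp2r.
Qed.

(** Each full block of [2 ^ l] factors [1 + 2 ^ -l] costs at most 4, and so does the incomplete
    block. *)
Lemma succ_expn2_expn (l n : nat) :
  (2 ^ l).+1 ^ n <= 4 ^ (n %/ 2 ^ l).+1 * (2 ^ l) ^ n.
Proof.
have base (N : nat) : 0 < N -> N.+1 ^ N <= 4 * N ^ N ->
    N.+1 ^ n <= 4 ^ (n %/ N).+1 * N ^ n.
  move=> N_gt0 le4.
  have h1 : N.+1 ^ (n %% N) <= 4 * N ^ (n %% N).
    have hr : n %% N <= N by rewrite ltnW // ltn_mod.
    rewrite -(leq_pmul2r (_ : 0 < N ^ (N - n %% N))) ?expn_gt0 ?N_gt0 //.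
    rewrite -mulnA -expnD subnKC //.
    apply: leq_trans le4.
    have -> : N.+1 ^ N = N.+1 ^ (n %% N) * N.+1 ^ (N - n %% N).
      by rewrite -expnD subnKC.
    by rewrite leq_mul2l leq_expn2r ?orbT.
  rewrite {1 3}(divn_eq n N) !expnD expnSr.
  rewrite -mulnA [4 * _]mulnCA mulnA.
  apply: leq_mul => //.
  by rewrite !(mulnC (_ %/ _)) !expnM -expnMn leq_expn2r.
apply: base; first by rewrite expn_gt0.
(* For [l = 0] the base is 1, which is not of the doubled form required below. *)
case: l => [|l]; first by [].
by rewrite expnS mul2n succ_expn_double.
Qed.

(** Since [2 * 7 ^ 6 <= 8 ^ 6], twelve random targets all hit a set of density 7/8 with probability
    at most 1/4. *)
Lemma expn_seven_eighths (b m l : nat) :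
  8 * b <= 7 * m -> 4 ^ l * b ^ (12 * l) <= m ^ (12 * l).
Proof.
move=> hb; rewrite !expnM -expnMn; apply: leq_expn2r.
have h2 : (2 * b ^ 6 <= m ^ 6).
  have h6 : (8 * b) ^ 6 <= (7 * m) ^ 6 by apply: leq_expn2r.
  rewrite !expnMn in h6.
  have c : 2 * 7 ^ 6 <= 8 ^ 6 by apply/leP; rewrite /expn /=; lia.
  move: h6 c; move: (7 ^ 6) (8 ^ 6) (expn_gt0 7 6) => u v u0 h6 c; nia.
have := leq_expn2r 2 h2.
by rewrite expnMn -!expnM.
Qed.

(** * Random choices of targets *)

Section Sampler.
Variables (J K : finType) (l : nat).
Let k := 12 * l.

(** The sources choose their targets independently, so the moment factors over the sources. *)
Lemma sum_expn_count (C : {set K}) (w : nat) :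
  \sum_(a : {ffun J -> {ffun 'I_k -> K}}) w ^ #|[set j | a j \in ffun_on (mem C)]|
   = (\sum_(f : {ffun 'I_k -> K}) (if f \in ffun_on (mem C) then w else 1)) ^ #|J|.
Proof.
rewrite -[RHS]prod_nat_const bigA_distr_bigA; apply: eq_bigr => a _.
rewrite -prod_nat_const big_mkcond /=; apply: eq_bigr => j _.
by rewrite inE.
Qed.

Lemma sum_ffun_weight (C : {set K}) (w : nat) :
  \sum_(f : {ffun 'I_k -> K}) (if f \in ffun_on (mem C) then w else 1)
    <= #|K| ^ k + w * #|C| ^ k.
Proof.
have -> : #|K| ^ k = \sum_(f : {ffun 'I_k -> K}) 1.
  by rewrite sum1_card card_ffun card_ord.
have -> : w * #|C| ^ k = \sum_(f : {ffun 'I_k -> K} | f \in ffun_on (mem C)) w.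
  by rewrite sum_nat_const card_ffun_on card_ord mulnC.
rewrite [X in _ + X]big_mkcond -big_split /=; apply: leq_sum => f _.
by case: ifP => // _; rewrite leq_addl.
Qed.

(* First moment of the weight [2 ^ (l * X)], where [X] counts the sources all
   of whose [k] targets fall in [C], summed over all [C]. *)
Lemma sampler_exists : 0 < #|K| ->
  exists a : {ffun J -> {ffun 'I_k -> K}}, forall C : {set K},
    8 * #|C| <= 7 * #|K| ->
    l * #|[set j | a j \in ffun_on (mem C)]| <= #|K| + 2 * (#|J| %/ 2 ^ l) + 2.
Proof.
move=> K_gt0; set bound := _ + _ + 2.
pose bad (a : {ffun J -> {ffun 'I_k -> K}}) (C : {set K}) :=
  (8 * #|C| <= 7 * #|K|) && (bound < l * #|[set j | a j \in ffun_on (mem C)]|).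
case: (boolP [exists a, ~~ [exists C, bad a C]]) => [/existsP[a]|].
  rewrite negb_exists => /forallP good; exists a => C hC.
  by have := good C; rewrite /bad hC /= -leqNgt.
rewrite negb_exists => /forallP allbad; exfalso.
set S := \sum_(a : {ffun J -> {ffun 'I_k -> K}}) \sum_(C : {set K} | 8 * #|C| <= 7 * #|K|)
  2 ^ (l * #|[set j | a j \in ffun_on (mem C)]|).
(* Every assignment has a bad set, whose weight alone is at least [2 ^ bound.+1]. *)
have lower : (#|K| ^ k) ^ #|J| * 2 ^ bound.+1 <= S.
  have -> : (#|K| ^ k) ^ #|J| = #|{ffun J -> {ffun 'I_k -> K}}|.
    by rewrite !card_ffun card_ord.
  rewrite -sum_nat_const; apply: leq_sum => a _.
  have /existsP[C /andP[hC hb]] := negbNE (allbad a).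
  by rewrite (bigD1 C) //= (leq_trans _ (leq_addr _ _)) // leq_exp2l.
(* For each of at most [2 ^ #|K|] sets, one source contributes a mean factor of at most
   [1 + 2 ^ l * 4 ^ -l = 1 + 2 ^ -l]. *)
have upper : S * (2 ^ l) ^ #|J| <= 2 ^ #|K| * ((#|K| ^ k) ^ #|J| * (2 ^ l).+1 ^ #|J|).
  rewrite /S exchange_big /= big_distrl /=.
  have -> : 2 ^ #|K| = #|{set K}|.
    by rewrite -[RHS]cardsT -powersetT card_powerset cardsT.
  rewrite -sum_nat_const [leqRHS](bigID (fun C : {set K} => 8 * #|C| <= 7 * #|K|)) /=.
  apply: leq_trans (leq_addr _ _); apply: leq_sum => C hC.
  under eq_bigr do rewrite expnM.
  rewrite sum_expn_count -!expnMn; apply: leq_expn2r.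
  apply: leq_trans (leq_mul (sum_ffun_weight _ _) (leqnn _)) _.
  rewrite mulnDl mulnS addnC leq_add //.
  by rewrite mulnAC -expnMn; apply: expn_seven_eighths.
have := leq_mul lower (leqnn ((2 ^ l) ^ #|J|)).
move=> /leq_trans /(_ upper).
rewrite mulnCA -!mulnA leq_pmul2l ?expn_gt0 ?K_gt0 //.
have := succ_expn2_expn l #|J|.
rewrite -(leq_pmul2l (_ : 0 < 2 ^ #|K|)) ?expn_gt0 // => h /leq_trans /(_ h).
rewrite mulnA leq_pmul2r ?expn_gt0 //.
(* Comparing exponents leaves [bound.+1 <= bound]. *)
rewrite -[4]/(2 ^ 2) -expnM -expnD leq_exp2l // /bound; lia.
Qed.

End Sampler.

(** A source missing [Y] has all its targets in [L] outside [Y], a set of density at most 7/8, to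
    which the sampler bound applies. *)
Lemma sampler_rel_exists (T : finType) (S L : {set T}) (l : nat) : 0 < #|L| ->
  exists G : rel T,
    [/\ forall u v, G u v -> u \in S /\ v \in L,
        forall u, #|[set v | G u v]| <= 12 * l
      & forall Y : {set T}, Y \subset L -> #|L| <= 8 * #|Y| ->
          l * #|[set u in S | [forall v in Y, ~~ G u v]]|
            <= #|L| + 2 * (#|S| %/ 2 ^ l) + 2].
Proof.
move=> L_gt0; pose J := {u | u \in S}; pose K := {v | v \in L}.
have cJ : #|{: J}| = #|S| by rewrite card_sig; apply: eq_card.
have cK : #|{: K}| = #|L| by rewrite card_sig; apply: eq_card.
have [|a aP] := @sampler_exists J K l; first by rewrite cK.
exists (fun u v => [exists j : J, exists i, (val j == u) && (val (a j i) == v)]).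
split=> [u v /existsP[j /existsP[i /andP[/eqP<- /eqP<-]]]|u|Y YL hY].
- by split; apply: valP.
- have [uS|uS] := boolP (u \in S); last first.
    rewrite (_ : [set v | _] = set0) ?cards0 //; apply/setP => v; rewrite !inE.
    apply/negbTE; apply: contra uS => /existsP[j /existsP[i /andP[/eqP<- _]]].
    exact: valP.
  pose j0 : J := Sub u uS.
  apply: (@leq_trans #|[set val (a j0 i) | i : 'I_(12 * l)]|).
    apply: subset_leq_card; apply/subsetP => v; rewrite !inE.
    move=> /existsP[j /existsP[i /andP[/eqP ju /eqP<-]]].
    have -> : j = j0 by apply: val_inj.
    exact: imset_f.
  by apply: leq_trans (leq_imset_card _ _) _; rewrite card_ord.
- pose C := [set c : K | val c \notin Y].
  have YE : #|~: C| = #|Y|.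
    rewrite -(card_imset _ val_inj); apply: eq_card => y; apply/imsetP/idP.
      by case=> c; rewrite !inE negbK => hc ->.
    by move=> yY; exists (Sub y (subsetP YL y yY) : K); rewrite ?inE ?negbK ?SubK.
  have CE := cardsC C; rewrite YE cK in CE.
  have hC : 8 * #|C| <= 7 * #|L| by lia.
  have := aP C; rewrite cK cJ => /(_ hC); apply: leq_trans.
  rewrite leq_mul2l; apply/orP; right.
  rewrite -(card_imset _ val_inj); apply: subset_leq_card; apply/subsetP => u.
  rewrite inE => /andP[uS /forallP hu]; apply/imsetP.
  exists (Sub u uS : J) => //; rewrite inE; apply/ffun_onP => i.
  rewrite inE; apply/negP => yY.
  have := hu (val (a (Sub u uS) i)); rewrite yY /= => /existsP[].
  by exists (Sub u uS); apply/existsP; exists i; rewrite !eqxx.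
Qed.

Lemma expander_exists (T : finType) (L : {set T}) : 0 < #|L| ->
  exists E : rel T,
    [/\ symmetric E, #|[set p : T * T | E p.1 p.2]| <= 1152 * #|L|
      & forall X Y : {set T}, X \subset L -> Y \subset L ->
          #|L| <= 8 * #|X| -> #|L| <= 8 * #|Y| ->
          exists x y, [/\ x \in X, y \in Y & E x y]].
Proof.
(* With [12 * 48] targets per node, fewer than [#|L| / 8] nodes miss [Y].  The
   constant is kept abstract so that [2 ^ 48] is never evaluated. *)
move=> L_gt0; have [d hd] : exists d, d == 48 by exists 48.
have [G [GL Gdeg Gsamp]] := sampler_rel_exists L d L_gt0.
exists (fun u v => G u v || G v u); split=> [u v||X Y XL YL hX hY].
- by rewrite orbC.
- have cG : #|[set p : T * T | G p.1 p.2]| <= 576 * #|L|.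
    have -> : [set p : T * T | G p.1 p.2] = [set p in setX L setT | G p.1 p.2].
      apply/setP => -[u v]; rewrite !inE /= andbT.
      by case: (boolP (G u v)) => [/GL[-> _]|_]; rewrite ?andbF.
    rewrite -sum1_card (eq_bigl (fun p : T * T => (p.1 \in L) && G p.1 p.2)); last first.
      by case=> u v; rewrite !inE /= andbT.
    rewrite -(pair_big_dep (fun u => u \in L) (fun u v => G u v) (fun _ _ => 1)) /=.
    rewrite mulnC -sum_nat_const; apply: leq_sum => u _.
    rewrite sum1_card; apply: leq_trans (leq_trans _ (Gdeg u)) _; last by rewrite (eqP hd).
    by apply: subset_leq_card; apply/subsetP => v; rewrite !inE.
  pose swap (p : T * T) := (p.2, p.1).
  have -> : [set p : T * T | G p.1 p.2 || G p.2 p.1] =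
      [set p : T * T | G p.1 p.2] :|: swap @^-1: [set p : T * T | G p.1 p.2].
    by apply/setP => -[u v]; rewrite !inE.
  rewrite cardsU (leq_trans (leq_subr _ _)) //.
  have -> : #|swap @^-1: [set p : T * T | G p.1 p.2]| = #|[set p : T * T | G p.1 p.2]|.
    by rewrite on_card_preimset //; apply: onW_bij; exists swap; case.
  lia.
- have := Gsamp Y YL hY.
  set Z := [set u in L | _].
  have [XsZ|/subsetPn[x xX /negbTE]] := boolP (X \subset Z).
    (* If all of [X] missed [Y], then [48 * #|X|], which is at least [6 * #|L|], would be at most
       [3 * #|L| + 2]. *)
    have := subset_leq_card XsZ => cXZ hd'.
    have : #|L| %/ 2 ^ d <= #|L| by apply: leq_div.
    by move: hd' hX cXZ; rewrite (eqP hd); move: (#|L| %/ _) => z; lia.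
  rewrite inE (subsetP XL) //= => /negbT; rewrite negb_forall => /existsP[y].
  by rewrite negb_imply negbK => /andP[yY Gxy] _; exists x, y; rewrite Gxy.
Qed.

(** * The core of a damaged expander *)

Section Core.
Variables (T : finType) (E : rel T).

(** One round of flooding from [S] that reaches new nodes in [Q] only. *)
Definition grow (Q S : {set T}) : {set T} :=
  S :|: [set v in Q | [exists u in S, E u v]].

Lemma growS Q (S1 S2 : {set T}) : S1 \subset S2 -> grow Q S1 \subset grow Q S2.
Proof.
move=> sS; apply: setUSS => //; apply/subsetP => v; rewrite !inE.
case/andP=> -> /existsP[u /andP[uS Euv]]; apply/existsP; exists u.
by rewrite (subsetP sS).
Qed.

Lemma iter_growS Q r (S1 S2 : {set T}) :
  S1 \subset S2 -> iter r (grow Q) S1 \subset iter r (grow Q) S2.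
Proof. by move=> sS; elim: r => //= r; apply: growS. Qed.

Lemma iter_grow_sub (Q S : {set T}) r : S \subset Q -> iter r (grow Q) S \subset Q.
Proof.
move=> SQ; elim: r => //= r IHr; rewrite subUset IHr /=.
by apply/subsetP => v; rewrite inE => /andP[].
Qed.

Lemma iter_grow_trans Q r s x y z : y \in iter r (grow Q) [set x] ->
  z \in iter s (grow Q) [set y] -> z \in iter (s + r) (grow Q) [set x].
Proof.
move=> yx; rewrite iterD; apply: (subsetP (iter_growS _ _ _)).
by rewrite sub1set.
Qed.

Lemma iter_grow_sym (Q : {set T}) r x y : symmetric E -> x \in Q ->
  y \in iter r (grow Q) [set x] -> x \in iter r (grow Q) [set y].
Proof.
move=> symE xQ; elim: r y => [|r IHr] y /=; first by rewrite !inE eq_sym.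
rewrite {1}/grow inE => /orP[/IHr xy|]; first by rewrite /grow inE xy.
rewrite inE => /andP[yQ /existsP[u /andP[ux Euy]]].
have uQ : u \in Q by apply: (subsetP (iter_grow_sub r _) u ux); rewrite sub1set.
rewrite -iterS -addn1; apply: (iter_grow_trans _ (IHr _ ux)).
rewrite /= !inE uQ /=; apply/orP; right; apply/existsP; exists y.
by rewrite inE eqxx /= symE.
Qed.

Variables (L F : {set T}).
Hypotheses (symE : symmetric E) (L_gt0 : 0 < #|L|) (few : 5 * #|F| <= #|L|).
Hypothesis expanding : forall X Y : {set T}, X \subset L -> Y \subset L ->
  #|L| <= 8 * #|X| -> #|L| <= 8 * #|Y| -> exists x y, [/\ x \in X, y \in Y & E x y].

(* [Q] is what remains of [L :\: F] after removing a largest set that does not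
   expand; a set that does not expand in [Q] could have been removed too. *)
Lemma core_exists : exists Q : {set T},
  [/\ Q \subset L, [disjoint Q & F], #|L| < 2 * #|Q|
    & forall p q, p \in Q -> q \in Q ->
        q \in iter (2 * (trunc_log 2 #|L|).+1).+1 (grow Q) [set p]].
Proof.
pose W := L :\: F; pose m := #|L|.
pose bd (A S : {set T}) := [set v in A | [exists u in S, E u v]] :\: S.
pose ok (Z : {set T}) := [&& Z \subset W, 4 * #|Z| < m & #|bd W Z| <= #|Z|].
have ok0 : ok set0.
  rewrite /ok sub0set cards0 muln0 L_gt0 leqn0 cards_eq0 -subset0.
  apply/subsetP => v; rewrite !inE => /andP[_ /andP[_ /existsP[u]]].
  by rewrite inE.
case: (@arg_maxnP _ set0 ok (fun Z => #|Z|) ok0) => Z /and3P[ZW Zm Zbd] Zmax.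
have WL : W \subset L by apply: subsetDl.
have cW : m <= #|W| + #|F|.
  by rewrite /m -(cardsID F L) addnC leq_add2l subset_leq_card // subsetIr.
(* Otherwise [Z] and the rest of [W] beyond its boundary, at least [4/5 - 2/4] of [L], are both
   large and yet not joined. *)
have Zsmall : 8 * #|Z| < m.
  rewrite ltnNge; apply/negP => Zbig.
  pose Y := W :\: (Z :|: bd W Z).
  have cY : m <= 8 * #|Y|.
    have := cardsID (Z :|: bd W Z) W; have := leq_card_setU Z (bd W Z).
    have := subset_leq_card (subsetIr W (Z :|: bd W Z)).
    rewrite -/Y => -h1 [h2 _] h3. move: few; rewrite -/m; lia.
  have [x [y [xZ yY Exy]]] :=
    expanding (subset_trans ZW WL) (subset_trans (subsetDl W _) WL : Y \subset L) Zbig cY.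
  move: yY; rewrite !inE negb_or => /andP[/andP[yZ]].
  rewrite yZ /= => /negP nb yW; apply: nb; rewrite yW /=.
  by apply/existsP; exists x; rewrite xZ.
pose Q := W :\: Z; exists Q.
have QW : Q \subset W by apply: subsetDl.
have cQ : #|Z| + #|Q| = #|W|.
  by rewrite -(cardsID Z W) (setIidPr ZW).
(* If [S] failed to double, [Z :|: S] would be admissible and larger than [Z]; both parts have at
   most [m / 8] nodes, hence the threshold [m / 4] in [ok]. *)
have grows (S : {set T}) : S \subset Q -> S != set0 -> 8 * #|S| <= m ->
    2 * #|S| < #|grow Q S|.
  move=> SQ S0 Sm; rewrite ltnNge; apply/negP => gS.
  have dSZ : [disjoint Z & S].
    rewrite disjoint_sym; apply: disjointWl SQ _.
    by rewrite disjoint_sym disjoints_subset setCD subsetUr.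
  have cSZ : #|Z :|: S| = #|Z| + #|S| by apply/eqP; rewrite (leq_card_setU Z S).
  have bdS : #|bd Q S| <= #|S|.
    have : #|grow Q S| = #|S| + #|bd Q S|.
      rewrite /grow -(cardsID S) setUK setDUl setDv set0U.
      by congr (#|_| + _); apply/setP => v; rewrite !inE; case: (v \in S).
    lia.
  have : #|Z :|: S| <= #|Z|.
    apply: Zmax; rewrite /ok subUset ZW (subset_trans SQ QW) /= cSZ.
    apply/andP; split; first by lia.
    apply: leq_trans (leq_add Zbd bdS).
    apply: leq_trans (leq_card_setU _ _).
    apply: subset_leq_card; apply/subsetP => v; rewrite !inE negb_or.
    case/andP=> /andP[vZ vS] /andP[vW /existsP[u /andP[]]].
    rewrite inE vZ vS vW /= => /orP[] hu Euv; apply/orP; [left|right];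
      by apply/existsP; exists u; rewrite hu.
  by rewrite cSZ; move: S0; rewrite -card_gt0; lia.
(* Balls in [Q] double until they exceed [m / 8] nodes. *)
have ball p r : p \in Q -> (2 ^ r <= #|iter r (grow Q) [set p]|) ||
    (m < 8 * #|iter r (grow Q) [set p]|).
  move=> pQ; elim: r => [|r IHr] /=; first by rewrite cards1.
  set B := iter r _ _ in IHr *.
  have BQ : B \subset Q by apply: iter_grow_sub; rewrite sub1set.
  have mono : #|B| <= #|grow Q B| by apply: subset_leq_card; apply: subsetUl.
  have [Bm|Bm] := leqP (8 * #|B|) m; last by apply/orP; right; lia.
  have B0 : B != set0.
    apply/set0Pn; exists p; rewrite /B; elim: (r) => [|s IHs] /=; first exact: set11.
    by rewrite /grow inE IHs.
  have := grows B BQ B0 Bm; move: IHr; rewrite expnS; case/orP => h; lia.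
have big p : p \in Q -> m <= 8 * #|iter (trunc_log 2 m).+1 (grow Q) [set p]|.
  move=> pQ; have := ball p (trunc_log 2 m).+1 pQ.
  have := @trunc_log_ltn 2 m isT; move: (2 ^ _) => z hz; case/orP; lia.
split=> [|||p q pQ qQ].
- exact: subset_trans QW WL.
- by apply: disjointWl QW _; rewrite disjoint_sym disjoints_subset setCD subsetUr.
- by move: few; rewrite -/m; lia.
- have sub x : x \in Q -> iter (trunc_log 2 m).+1 (grow Q) [set x] \subset L.
    move=> xQ; apply: subset_trans (iter_grow_sub _ _) (subset_trans QW WL).
    by rewrite sub1set.
  (* Large balls around [p] and [q] are joined by an edge, so the diameter is at most twice the
     radius plus one. *)
  have [x [y [xp yq Exy]]] := expanding (sub p pQ) (sub q qQ) (big p pQ) (big q qQ).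
  have yQ : y \in Q by apply: (subsetP (iter_grow_sub _ _) y yq); rewrite sub1set.
  have yx : y \in iter 1 (grow Q) [set x].
    rewrite /= in_setU; apply/orP; right; rewrite inE yQ.
    by apply/existsP; exists x; rewrite set11.
  have -> : (2 * (trunc_log 2 #|L|).+1).+1 =
      (trunc_log 2 m).+1 + (1 + (trunc_log 2 m).+1) by rewrite /m; lia.
  exact: iter_grow_trans (iter_grow_trans xp yx) (iter_grow_sym symE qQ yq).
Qed.

End Core.

(** * The protocol and its executions *)

Section GossipProtocol.
Variables (n m D lv : nat) (E : rel 'I_n) (G : nat -> rel 'I_n).

(** One round of requests, [2 * D] rounds of flooding and one round of acknowledgements. *)
Definition period := (2 * D).+2.
Definition horizon := 2 * lv * period.
Definition offset r := r %% period.
Definition phase r := r %/ period.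
(** False during the first run of the [lv] phases, true during the second. *)
Definition stage r : bool := lv <= phase r.
Definition level r := phase r %% lv.

(* The fact [(q, b, j)] says that node [q] has learnt, possibly indirectly, of
   the request of node [j] in stage [b]. *)
Definition fact := ('I_n * bool * 'I_n)%type.

Definition certified (W : {set fact}) (b : bool) (j : 'I_n) :=
  m < 2 * #|[set q : 'I_n | (q < m) && ((q, b, j) \in W)]|.

Variable V : choiceType.

Record node_state := NodeState {
  self : 'I_n;
  clock : nat;
  rumors : {fset 'I_n * V};
  facts : {set fact};
  askers : {set 'I_n};
  served : {set bool}
}.

Definition packet := ({fset 'I_n * V} * {set fact})%type.

Definition own_facts s := (self s, stage (clock s), self s) |: facts s.

Definition addresses s (j : 'I_n) : bool :=
  let o := offset (clock s) in
  if o == 0 then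
    (stage (clock s) \notin served s) && G (level (clock s)) (self s) j
  else if o <= 2 * D then E (self s) j
  else (j \in askers s) && certified (facts s) (stage (clock s)) j.

Definition node_init (i : 'I_n) (v : V) : node_state :=
  NodeState i 0 [fset (i, v)]%fset set0 set0 set0.

Definition node_send s j : option packet :=
  if addresses s j then Some (rumors s, own_facts s) else None.

Definition heard_rumors (msg : 'I_n -> option packet) : {fset 'I_n * V} :=
  (\bigcup_(j <- enum 'I_n) (if msg j is Some p then p.1 else fset0))%fset.

Definition heard_facts (msg : 'I_n -> option packet) : {set fact} :=
  \bigcup_j (if msg j is Some p then p.2 else set0).

(** Hearing that anybody has learnt of a request amounts to learning of it; [i] adds this fact about
    itself, to be counted in certificates. *)
Definition digest (i : 'I_n) (W : {set fact}) : {set fact} :=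
  W :|: [set x : fact | (x.1.1 == i) && [exists q, (q, x.1.2, x.2) \in W]].

Definition node_receive s (msg : 'I_n -> option packet) : node_state :=
  let o := offset (clock s) in
  let b := stage (clock s) in
  NodeState (self s) (clock s).+1
    (rumors s `|` heard_rumors msg)%fset
    (digest (self s) (own_facts s :|: heard_facts msg))
    (if o == 0 then [set j | isSome (msg j)] else askers s)
    (* Only acknowledgements are sent in this round. The second alternative serves a node that is
       its own neighbour and so cannot write to itself. *)
    (if (o == (2 * D).+1) &&
        ([exists j, isSome (msg j)] || certified (facts s) b (self s))
     then b |: served s else served s).

Definition node_decision s : option {fset 'I_n * V} :=
  if clock s == horizon then Some (rumors s) else None.

Definition gossip_protocol : protocol n V :=
  Protocol node_init node_send node_receive node_decision.

(** * Executions described by ghost states *)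

Variables (rumor : 'I_n -> V) (crash : crash_schedule n).

Local Notation config := (config gossip_protocol rumor crash).

(** A node still counts as alive in its crash round, where it may reach some addressees. *)
Definition alive r i := if crash i is Some (r', _) then r <= r' else true.

(* The state of node [i] after [r] rounds, as if crashed nodes went on
   listening and nobody halted. *)
Fixpoint ghost r : 'I_n -> node_state :=
  if r is r'.+1 then fun i => node_receive (ghost r' i) (fun j =>
    if [&& alive r' j, i != j & ~~ suppressed crash r' j i]
    then node_send (ghost r' j) i else None)
  else fun i => node_init i (rumor i).

Definition hear r j i :=
  if [&& alive r j, i != j & ~~ suppressed crash r j i]
  then node_send (ghost r j) i else None.

Lemma ghostS r i : ghost r.+1 i = node_receive (ghost r i) (hear r ^~ i).
Proof. by []. Qed.

Lemma self_ghost r i : self (ghost r i) = i.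
Proof. by elim: r => //= r. Qed.

Lemma clock_ghost r i : clock (ghost r i) = r.
Proof. by elim: r => //= r ->. Qed.

Lemma aliveS r i : alive r.+1 i = alive r i && ~~ crashes_in crash r i.
Proof.
rewrite /alive /crashes_in; case: (crash i) => [[r' B]|] //=.
by rewrite ltn_neqAle eq_sym andbC.
Qed.

Lemma alive_le r s i : r <= s -> alive s i -> alive r i.
Proof. by rewrite /alive; case: (crash i) => [[r' B]|] // /leq_trans; apply. Qed.

Lemma suppressedN r i j : alive r.+1 i -> ~~ suppressed crash r i j.
Proof.
rewrite /alive /suppressed; case: (crash i) => [[r' B]|] // lt_r.
by rewrite gtn_eqF.
Qed.

(** Ghosts receive messages from alive nodes only, so the ghost states of crashed nodes influence
    nobody. *)
Lemma configE r i : r <= horizon ->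
  config r i = if alive r i then
                 if r == horizon then Halted gossip_protocol (rumors (ghost r i))
                 else Active (ghost r i : state gossip_protocol)
               else Crashed gossip_protocol.
Proof.
elim: r i => [|r IHr] i hr.
  rewrite /= /settle /= /node_decision /=.
  have -> : alive 0 i by rewrite /alive; case: (crash i) => [[]|].
  by case: eqP.
have IH j : config r j = if alive r j then Active (ghost r j : state gossip_protocol)
                         else Crashed gossip_protocol.
  by rewrite IHr ?(ltnW hr) // (ltn_eqF hr).
rewrite -[config r.+1 i]/(Defs.next crash r (config r) i) /Defs.next IH aliveS.
case: (alive r i) => //=.
case: (crashes_in crash r i) => //=.
have -> : (fun j => outgoing crash r (config r) j i) = hear r ^~ i.
  apply/funext => j; rewrite /outgoing /hear IH.
  case: (alive r j) => //=; rewrite (eq_sym i j).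
  by case: (j == i) => //=; case: suppressed.
rewrite /settle /= /node_decision -[node_receive _ _]/(ghost r.+1 i) clock_ghost.
by case: eqP => // <-.
Qed.

Definition hears r j i := isSome (hear r j i).

Definition own r i := own_facts (ghost r i).

Lemma hearE r j i :
  hear r j i = if hears r j i then Some (rumors (ghost r j), own r j) else None.
Proof. by rewrite /hears /hear /node_send; case: ifP => // _; case: ifP. Qed.

Lemma hearsP r j i : reflect
  [/\ alive r j, i != j, ~~ suppressed crash r j i & addresses (ghost r j) i]
  (hears r j i).
Proof.
rewrite /hears /hear /node_send; apply: (iffP idP).
  by case: ifP => // /and3P[-> -> ->]; case: ifP.
by case=> -> -> -> ->.
Qed.

Lemma servedS r i : served (ghost r.+1 i) =
  if (offset r == (2 * D).+1) &&
     ([exists j, hears r j i] || certified (facts (ghost r i)) (stage r) i)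
  then stage r |: served (ghost r i) else served (ghost r i).
Proof. by rewrite ghostS /= self_ghost clock_ghost. Qed.

Lemma askersS r i : askers (ghost r.+1 i) =
  if offset r == 0 then [set j | hears r j i] else askers (ghost r i).
Proof. by rewrite ghostS /= clock_ghost. Qed.

Lemma mem_own x r i : (x \in own r i) = (x == (i, stage r, i)) || (x \in facts (ghost r i)).
Proof. by rewrite !inE self_ghost clock_ghost. Qed.

Lemma rumorsSP x r i : reflect
  (exists2 k, (k == i) || hears r k i & x \in rumors (ghost r k))
  (x \in rumors (ghost r.+1 i)).
Proof.
rewrite ghostS /= in_fsetU; apply: (iffP orP) => [[xi|]|[k /orP[/eqP->|ki] xk]].
- by exists i; rewrite ?eqxx.
- case/bigfcupP => k _; rewrite hearE; case: ifP => // ki xk.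
  by exists k; rewrite ?ki ?orbT.
- by left.
- right; apply/bigfcupP; exists k; first by rewrite mem_enum.
  by rewrite hearE ki.
Qed.

Lemma factsSP q b j r i : reflect
  (exists2 k, (k == i) || hears r k i &
     (q, b, j) \in own r k \/ q = i /\ exists q', (q', b, j) \in own r k)
  ((q, b, j) \in facts (ghost r.+1 i)).
Proof.
have poolP x : reflect (exists2 k, (k == i) || hears r k i & x \in own r k)
    (x \in own r i :|: heard_facts (hear r ^~ i)).
  rewrite inE; apply: (iffP orP) => [[xi|]|[k /orP[/eqP->|ki] xk]].
  - by exists i; rewrite ?eqxx.
  - case/bigcupP => k _; rewrite hearE; case: ifP => [ki xk|_]; last by rewrite inE.
    by exists k; rewrite ?ki ?orbT.
  - by left.
  - by right; apply/bigcupP; exists k => //; rewrite hearE ki.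
rewrite ghostS /= self_ghost in_setU [in X in _ || X]inE /=.
apply: (iffP orP) => [[/poolP[k ki xk]|]|[k ki [xk|[-> [q' xk]]]]].
- by exists k; last by left.
- case/andP=> /eqP-> /existsP[q' /poolP[k ki xk]].
  by exists k => //; right; split=> //; exists q'.
- by left; apply/poolP; exists k.
- by right; rewrite eqxx; apply/existsP; exists q'; apply/poolP; exists k.
Qed.

(** * Propagation of rumors and facts *)

Lemma rumors_flow r k i : (k == i) || hears r k i ->
  {subset rumors (ghost r k) <= rumors (ghost r.+1 i)}.
Proof. by move=> ki x xk; apply/rumorsSP; exists k. Qed.

Lemma own_flow r k i : (k == i) || hears r k i ->
  {subset own r k <= facts (ghost r.+1 i)}.
Proof. by move=> ki [[q b] j] xk; apply/factsSP; exists k => //; left. Qed.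

Lemma facts_flow r k i : (k == i) || hears r k i ->
  {subset facts (ghost r k) <= facts (ghost r.+1 i)}.
Proof. by move=> ki x xk; apply: (own_flow ki); rewrite mem_own xk orbT. Qed.

Lemma rumors_mono r s i : r <= s ->
  {subset rumors (ghost r i) <= rumors (ghost s i)}.
Proof.
elim: s => [|s IHs]; first by rewrite leqn0 => /eqP->.
rewrite leq_eqVlt => /predU1P[-> //|le_rs] x /(IHs le_rs).
by apply: rumors_flow; rewrite eqxx.
Qed.

Lemma served_mono r s i : r <= s ->
  {subset served (ghost r i) <= served (ghost s i)}.
Proof.
elim: s => [|s IHs]; first by rewrite leqn0 => /eqP->.
rewrite leq_eqVlt => /predU1P[-> //|le_rs] x /(IHs le_rs).
by rewrite servedS; case: ifP => // _ xs; rewrite inE xs orbT.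
Qed.

Lemma own_rumor r i : (i, rumor i) \in rumors (ghost r i).
Proof. by apply: (@rumors_mono 0) => //=; rewrite inE. Qed.

(** A foreign rumor is traced back to a message sent by its owner, as condition (1) of gossiping
    demands. *)
Lemma rumors_sound r i x : x \in rumors (ghost r i) ->
  x.2 = rumor x.1 /\ (x.1 = i \/ exists r' k, r' < r /\ hears r' x.1 k).
Proof.
elim: r i => [|r IHr] i; first by rewrite /= inE => /eqP->; split=> //; left.
case/rumorsSP => k ki /IHr[-> origin]; split=> //.
case: origin => [xk|[r' [k' [lt_r' hk']]]]; last by right; exists r', k'; rewrite leqW.
by case/orP: ki => [/eqP<-|ki]; [left|right; exists r, i; rewrite xk].
Qed.

(** Facts on the request of [j] originate at [j], and every packet carries all rumors of its sender
    along with the facts. *)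
Lemma fact_rumor q b j r i :
  (q, b, j) \in facts (ghost r i) -> (j, rumor j) \in rumors (ghost r i).
Proof.
elim: r q i => [|r IHr] q i; first by rewrite /= inE.
case/factsSP => k ki hk.
have {hk} [q' hk] : exists q', (q', b, j) \in own r k.
  by case: hk => [|[_ //]]; exists q.
apply: (rumors_flow ki); move: hk; rewrite mem_own => /orP[/eqP[_ _ ->]|/IHr //].
exact: own_rumor.
Qed.

(** Only [q] creates facts about [q], and no fact is forgotten. *)
Lemma fact_true q b j r i :
  (q, b, j) \in facts (ghost r i) -> (q, b, j) \in facts (ghost r q).
Proof.
elim: r i => [|r IHr] i; first by rewrite /= inE.
move=> hf; case/factsSP: (hf) => k ki [|[qi _]]; last by rewrite qi in hf *.
rewrite mem_own => /orP[/eqP[-> -> ->]|/IHr].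
  by apply: (@own_flow r k); rewrite ?eqxx // mem_own eqxx.
by apply: facts_flow; rewrite eqxx.
Qed.

Lemma fact_digested q b j r i :
  (q, b, j) \in facts (ghost r i) -> (i, b, j) \in facts (ghost r i).
Proof.
case: r => [|r]; first by rewrite /= inE.
case/factsSP => k ki hk; apply/factsSP; exists k => //; right; split=> //.
by case: hk => [|[_ //]]; exists q.
Qed.

Definition midtime := lv * period.

Lemma stageE r : stage r = (midtime <= r).
Proof. by rewrite /stage /phase leq_divRL. Qed.

(** Node [q] creates such a fact in the second run, when it holds all it knew at [midtime]; from
    then on these rumors travel with the fact. *)
Lemma late_fact q j r i : (q, true, j) \in facts (ghost r i) ->
  midtime <= r /\ {subset rumors (ghost midtime q) <= rumors (ghost r i)}.
Proof.
elim: r q i => [|r IHr] q i; first by rewrite /= inE.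
case/factsSP => k ki hk.
have own_late q' : (q', true, j) \in own r k ->
    midtime <= r /\ {subset rumors (ghost midtime q') <= rumors (ghost r k)}.
  rewrite mem_own => /orP[/eqP[-> st _]|/IHr //].
  have le_r : midtime <= r by rewrite -stageE.
  by split=> //; apply: rumors_mono.
case: hk => [/own_late[le_r sub]|[-> [q' /own_late[le_r _]]]].
  by split=> [|x /sub]; [apply: leqW|apply: rumors_flow].
by split; [|apply: rumors_mono]; apply: leqW.
Qed.

Lemma certifiedS (W1 W2 : {set fact}) b j :
  {subset W1 <= W2} -> certified W1 b j -> certified W2 b j.
Proof.
move=> sW; rewrite /certified => /leq_trans; apply; rewrite leq_mul2l /=.
apply: subset_leq_card; apply/subsetP => q; rewrite !inE => /andP[-> /=].
exact: sW.
Qed.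

(** The acknowledgement contains the facts that justified it. *)
Lemma served_certified b r j :
  b \in served (ghost r j) -> certified (facts (ghost r j)) b j.
Proof.
elim: r => [|r IHr]; first by rewrite /= inE.
have mono k : (k == j) || hears r k j -> certified (facts (ghost r k)) b j ->
    certified (facts (ghost r.+1 j)) b j.
  by move=> kj; apply: certifiedS; apply: facts_flow.
rewrite servedS.
case: ifP => [/andP[/eqP off cert]|_ /IHr]; last by apply: mono; rewrite eqxx.
rewrite !inE => /predU1P[bE|/IHr]; last by apply: mono; rewrite eqxx.
rewrite -bE in cert; case/orP: cert => [/existsP[k kj]|]; last by apply: mono; rewrite eqxx.
apply: (mono k); first by rewrite kj orbT.
case/hearsP: kj => _ _ _; rewrite /addresses clock_ghost off /= ltnn -bE.
by case/andP.
Qed.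

(** * Outcome and messages of the actual execution *)

Lemma config_late r i : horizon <= r -> config r i = config horizon i.
Proof.
elim: r => [|r IHr]; first by rewrite leqn0 => /eqP->.
rewrite leq_eqVlt => /predU1P[-> //|le_r].
rewrite -[config r.+1 i]/(Defs.next crash r (config r) i) /Defs.next IHr //.
by rewrite configE // eqxx; case: ifP.
Qed.

Lemma decides_ghost i K : node_decides gossip_protocol rumor crash i K ->
  alive horizon i /\ K = rumors (ghost horizon i).
Proof.
case=> r; case: (leqP r horizon) => [le_r|/ltnW le_r]; last first.
  by rewrite config_late // configE // eqxx; case: ifP => // _ [->].
by rewrite configE //; case: ifP => // al; case: eqP => // <- [->].
Qed.

Lemma crashes_ghost i :
  node_crashes gossip_protocol rumor crash i -> ~~ alive horizon i.
Proof.
case=> r; case: (leqP r horizon) => [le_r|/ltnW le_r]; last first.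
  by rewrite config_late // configE // eqxx; case: ifP.
rewrite configE //; case: ifP => [_|dead _]; first by case: ifP.
by apply: contraFN dead; apply: alive_le.
Qed.

Lemma sendsE r i j :
  sends gossip_protocol rumor crash r i j = (r < horizon) && hears r i j.
Proof.
rewrite /sends /outgoing; have [lt_r|le_r] := ltnP r horizon; last first.
  by rewrite config_late // configE // eqxx; case: ifP.
rewrite configE ?(ltnW lt_r) // (ltn_eqF lt_r) /hears /hear.
case: ifP => //= _; by case: (j == i) => //=; case: suppressed.
Qed.

Lemma not_crashes_halted i : ~ node_crashes gossip_protocol rumor crash i ->
  halted_by gossip_protocol rumor crash horizon i.
Proof.
move=> nc; exists (rumors (ghost horizon i)); rewrite configE // eqxx.
by case: ifP => // dead; case: nc; exists horizon; rewrite configE // dead.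
Qed.

(** * Timetable and traffic of a phase *)

Lemma offset_in f o : o < period -> offset (f * period + o) = o.
Proof. by move=> lt_o; rewrite /offset modnMDl modn_small. Qed.

Lemma phase_in f o : o < period -> phase (f * period + o) = f.
Proof. by move=> lt_o; rewrite /phase divnMDl // divn_small // addn0. Qed.

Lemma stage_in f o : o < period -> stage (f * period + o) = (lv <= f).
Proof. by move=> lt_o; rewrite /stage phase_in. Qed.

Lemma addresses_ask f j p : addresses (ghost (f * period) j) p =
  ((lv <= f) \notin served (ghost (f * period) j)) && G (f %% lv) j p.
Proof.
rewrite /addresses clock_ghost self_ghost /level.
by rewrite -[f * period]addn0 offset_in ?stage_in ?phase_in.
Qed.

Lemma addresses_flood r u v : 0 < offset r <= 2 * D ->
  addresses (ghost r u) v = E u v.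
Proof.
by case/andP=> lo hi; rewrite /addresses clock_ghost self_ghost (gtn_eqF lo) hi.
Qed.

Lemma addresses_ack f p j :
  addresses (ghost (f * period + (2 * D).+1) p) j =
  (j \in askers (ghost (f * period + (2 * D).+1) p)) &&
  certified (facts (ghost (f * period + (2 * D).+1) p)) (lv <= f) j.
Proof. by rewrite /addresses clock_ghost offset_in // stage_in //= ltnn. Qed.

Lemma askers_phase f o p : o < (2 * D).+1 ->
  askers (ghost (f * period + o.+1) p) = [set j | hears (f * period) j p].
Proof.
elim: o => [|o IHo] lt_o.
  by rewrite addn1 askersS -{1}[f * period]addn0 offset_in.
by rewrite addnS askersS offset_in ?IHo // ltnW.
Qed.

Definition traffic r := #|[set p : 'I_n * 'I_n | hears r p.1 p.2]|.

Lemma messages_sent_traffic T :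
  messages_sent gossip_protocol rumor crash T <= \sum_(0 <= r < horizon) traffic r.
Proof.
rewrite /messages_sent; set f := fun r =>
  #|[set p : 'I_n * 'I_n | sends gossip_protocol rumor crash r p.1 p.2]|.
rewrite -(big_mkord xpredT f) [leqRHS](_ : _ = \sum_(0 <= r < horizon) f r).
  apply: (@leq_trans (\sum_(0 <= r < horizon + T) f r)).
    by rewrite [leqRHS](@big_cat_nat _ _ _ T) //= ?leq_addl // leq_addr.
  rewrite [leqLHS](@big_cat_nat _ _ _ horizon) //= ?leq_addr //.
  have -> : \sum_(horizon <= r < horizon + T) f r = 0; last by rewrite addn0.
  rewrite big_nat; apply: big1 => r /andP[le_r _].
  by apply: eq_card0 => p; rewrite inE sendsE ltnNge le_r.
apply: eq_big_nat => r /andP[_ lt_r]; apply: eq_card => p.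
by rewrite !inE sendsE lt_r.
Qed.

(** Acknowledgements go only to nodes whose requests arrived, so they at most double the request
    traffic. *)
Lemma phase_traffic f :
  \sum_(0 <= o < period) traffic (f * period + o)
    <= 2 * traffic (f * period) + 2 * D * #|[set p : 'I_n * 'I_n | E p.1 p.2]|.
Proof.
rewrite /period big_nat_recr // big_nat_recl //= -/period addn0.
have acks : traffic (f * period + (2 * D).+1) <= traffic (f * period).
  pose swap (p : 'I_n * 'I_n) := (p.2, p.1).
  have swapK : involutive swap by case.
  rewrite /traffic -(card_imset _ (inv_inj swapK)).
  apply: subset_leq_card; apply/subsetP => _ /imsetP[[p j] hp ->] /=.
  move: hp; rewrite !inE => /hearsP[_ _ _]; rewrite addresses_ack => /andP[+ _].
  by rewrite askers_phase // inE.
have floods : \sum_(0 <= o < 2 * D) traffic (f * period + o.+1)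
    <= 2 * D * #|[set p : 'I_n * 'I_n | E p.1 p.2]|.
  rewrite -[2 * D in leqRHS]subn0 -sum_nat_const_nat.
  apply: leq_sum_nat => o /andP[_ lt_o].
  apply: subset_leq_card; apply/subsetP => -[u v]; rewrite !inE => /hearsP[_ _ _].
  by rewrite addresses_flood // offset_in /period; lia.
apply: leq_trans (leq_add (leq_add (leqnn _) floods) acks) _.
by rewrite addnAC addnn -mul2n.
Qed.

(** The degree [12 * 2 ^ i'.+1] times the number of nodes that level [i'] leaves without a neighbour
    in the core. *)
Definition ask_bound i :=
  if i is i'.+1 then 24 * (m + 2 * (n %/ 2 ^ (2 ^ i')) + 2) else 12 * n.

Lemma sum_ask_bound : \sum_(0 <= i < lv) ask_bound i <= 60 * n + 24 * lv * (m + 2).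
Proof.
(* As [2 ^ i > i], a geometric series dominates; the extra summand is what remains for its later
   terms. *)
have halves k : \sum_(0 <= i < k) n %/ 2 ^ (2 ^ i) + n %/ 2 ^ k <= n.
  elim: k => [|k IHk]; first by rewrite big_nil expn0 divn1.
  rewrite big_nat_recr //=; apply: leq_trans IHk; rewrite -addnA leq_add2l.
  have le1 : n %/ 2 ^ (2 ^ k) <= n %/ 2 ^ k.+1.
    by apply: leq_div2l; rewrite ?expn_gt0 // leq_exp2l // ltn_expl.
  apply: leq_trans (leq_add le1 (leqnn _)) _.
  by rewrite expnS mulnC divnMA; lia.
case: (lv) => [|k]; first by rewrite big_nil.
rewrite big_nat_recl //= /ask_bound.
have -> : \sum_(0 <= i < k) 24 * (m + 2 * (n %/ 2 ^ (2 ^ i)) + 2) =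
    24 * (k * m + 2 * (\sum_(0 <= i < k) n %/ 2 ^ (2 ^ i)) + k * 2).
  by rewrite -big_distrr 2!big_split !sum_nat_const_nat subn0 -big_distrr.
have := halves k; move: (\sum_(0 <= i < k) _) (_ %/ _) => S x; nia.
Qed.

(** * Consequences of a correct core *)

Section WithCore.
Variable Q : {set 'I_n}.
Hypotheses (Q_low : forall q, q \in Q -> q < m)
  (Q_correct : forall q, q \in Q -> crash q = None)
  (Q_major : m < 2 * #|Q|)
  (Q_diam : forall p q, p \in Q -> q \in Q -> q \in iter D (grow E Q) [set p]).

(** Two strict majorities of the first [m] nodes intersect. *)
Lemma certified_core W b j :
  certified W b j -> exists2 q, q \in Q & (q, b, j) \in W.
Proof.
rewrite /certified; set A := [set q : 'I_n | _] => cert.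
have le_m : #|A :|: Q| <= m.
  apply: (@leq_trans #|[set q : 'I_n | q < m]|); last first.
    by rewrite card_ltn_ord geq_minr.
  apply: subset_leq_card.
  by apply/subsetP => q; rewrite !inE => /orP[/andP[] //|/Q_low].
have : 0 < #|A :&: Q|.
  move: (cardsUI A Q) Q_major cert le_m.
  by move: #|A| #|Q| #|A :|: Q| #|A :&: Q| => a c u i; lia.
by case/card_gt0P => q; rewrite !inE => /andP[/andP[_ qW] qQ]; exists q.
Qed.

Lemma alive_core r q : q \in Q -> alive r q.
Proof. by move/Q_correct => hq; rewrite /alive hq. Qed.

Lemma hears_core r q i : q \in Q -> i != q -> addresses (ghost r q) i ->
  hears r q i.
Proof.
move=> qQ iq adr; apply/hearsP; split=> //; first exact: alive_core.
by apply: suppressedN; apply: alive_core.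
Qed.

Lemma flood r k u v : u \in Q ->
  (forall i, i < k -> 0 < offset (r + i) <= 2 * D) ->
  v \in iter k (grow E Q) [set u] ->
  {subset rumors (ghost r u) <= rumors (ghost (r + k) v)} /\
  {subset facts (ghost r u) <= facts (ghost (r + k) v)}.
Proof.
move=> uQ; elim: k v => [|k IHk] v off /=; first by rewrite addn0 inE => /eqP->; split=> x.
have offk i : i < k -> 0 < offset (r + i) <= 2 * D by move=> /ltnW; apply: off.
have step w : w \in iter k (grow E Q) [set u] ->
    (w == v) || hears (r + k) w v ->
    {subset rumors (ghost r u) <= rumors (ghost (r + k.+1) v)} /\
    {subset facts (ghost r u) <= facts (ghost (r + k.+1) v)}.
  move=> /(IHk w offk)[sr sf] wv; rewrite addnS; split=> x.
    by move/sr; apply: rumors_flow.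
  by move/sf; apply: facts_flow.
rewrite {1}/grow in_setU => /orP[/step|]; first by rewrite eqxx => /(_ isT).
rewrite inE => /andP[vQ /existsP[w /andP[wS Ewv]]]; apply: (step w wS).
have [//|wv] := eqVneq w v; apply: hears_core.
- by apply: (subsetP (iter_grow_sub _ _ _) w wS); rewrite sub1set.
- by rewrite eq_sym.
- by rewrite addresses_flood ?off.
Qed.

Lemma flood_core f o u v : u \in Q -> v \in Q -> 0 < o -> o + D <= (2 * D).+1 ->
  {subset rumors (ghost (f * period + o) u) <= rumors (ghost (f * period + (o + D)) v)} /\
  {subset facts (ghost (f * period + o) u) <= facts (ghost (f * period + (o + D)) v)}.
Proof.
move=> uQ vQ o_gt0 le_o; rewrite addnA; apply: flood => // [i lt_i|]; last exact: Q_diam.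
by rewrite -addnA offset_in /period; lia.
Qed.

(** The first [D] flooding rounds spread the request from [p] over [Q], the other [D] bring the
    reports of all of [Q] back to [p], which then holds a certificate. *)
Lemma phase_served f j p : p \in Q -> alive (f * period).+1 j ->
  G (f %% lv) j p -> (lv <= f) \in served (ghost (f.+1 * period) j).
Proof.
move=> pQ alj Gjp; set b := lv <= f; set r0 := f * period.
have le_end : r0 <= f.+1 * period by rewrite leq_mul2r leqnSn orbT.
have [sv|nsv] := boolP (b \in served (ghost r0 j)); first exact: served_mono sv.
have eD : (2 * D).+1 = 1 + D + D by rewrite mul2n -addnn.
have lD : 1 + D <= (2 * D).+1 by rewrite eD leq_addr.
have asked : (j == p) || hears r0 j p.
  have [//|jp] := eqVneq j p; apply/hearsP.
  split; [exact: alive_le alj|by rewrite eq_sym|exact: suppressedN|].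
  by rewrite addresses_ask nsv.
have st0 : stage r0 = b by rewrite -[r0]addn0 stage_in.
have fact1 : (j, b, j) \in facts (ghost (r0 + 1) p).
  by rewrite addn1; apply: (own_flow asked); rewrite mem_own st0 eqxx.
have fact2 v : v \in Q -> (v, b, j) \in facts (ghost (r0 + (1 + D)) v).
  by move=> vQ; have := (@flood_core f 1 p v pQ vQ isT lD).2 _ fact1; apply: fact_digested.
have fact3 v : v \in Q -> (v, b, j) \in facts (ghost (r0 + (2 * D).+1) p).
  move=> vQ; rewrite eD.
  by have [||_] := @flood_core f (1 + D) v p vQ pQ; rewrite -?eD // => /(_ _ (fact2 v vQ)).
have cert : certified (facts (ghost (r0 + (2 * D).+1) p)) b j.
  apply: leq_trans Q_major _; rewrite leq_mul2l /=; apply: subset_leq_card.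
  by apply/subsetP => v vQ; rewrite inE Q_low //= fact3.
have -> : f.+1 * period = (r0 + (2 * D).+1).+1 by rewrite -addnS mulSnr.
rewrite servedS offset_in // eqxx stage_in //= ifT ?setU11 //.
(* A node that is its own neighbour is served by its own certificate. *)
have [jp|jp] := eqVneq j p; first by rewrite jp in cert *; rewrite cert orbT.
apply/orP; left; apply/existsP; exists p; apply: hears_core => //.
rewrite addresses_ack -/r0 cert andbT askers_phase // inE -/r0.
by move: asked; rewrite (negPf jp).
Qed.

Section Correctness.
Hypotheses (lv_ge2 : 2 <= lv)
  (G_last : forall j, exists2 p, p \in Q & G (lv - 2) j p).

(** Everybody is served by level [lv - 2], so that the last phase of the first run remains for
    flooding. *)
Lemma served_by_last (b : bool) j : alive horizon j ->
  b \in served (ghost ((b * lv + lv.-1) * period) j).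
Proof.
move=> alj; have [p pQ Gjp] := G_last j.
have lt2 : lv - 2 < lv by lia.
have := @phase_served (b * lv + (lv - 2)) j p pQ.
rewrite modnMDl modn_small // => /(_ _ Gjp).
have -> : (lv <= b * lv + (lv - 2)) = b by case: (b); lia.
have -> : (b * lv + (lv - 2)).+1 = b * lv + lv.-1 by case: (b); lia.
apply; apply: alive_le alj; rewrite /horizon.
have : (b * lv + (lv - 2)).+1 <= 2 * lv by case: (b); lia.
by rewrite -(leq_pmul2r (_ : 0 < period)) // /period; lia.
Qed.

(** The certificate of [j] names a core member that knows its rumor; the last phase of the first run
    spreads it over the core. *)
Lemma core_knows j q : alive horizon j -> q \in Q ->
  (j, rumor j) \in rumors (ghost midtime q).
Proof.
move=> alj qQ; have := served_by_last false alj; rewrite mul0n add0n.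
set r := lv.-1 * period => /served_certified/certified_core[u uQ /fact_true/fact_rumor ru].
have {}ru : (j, rumor j) \in rumors (ghost (r + 1) u).
  by apply: rumors_mono ru; rewrite leq_addr.
have le1 : 1 + D <= (2 * D).+1 by lia.
have [sub _] := @flood_core lv.-1 1 u q uQ qQ isT le1.
apply: rumors_mono (sub _ ru); rewrite /midtime -/r.
have -> : lv * period = r + period by rewrite /r -mulSnr prednK // ltnW.
by rewrite leq_add2l /period; lia.
Qed.

Lemma gossip_correct : gossiping gossip_protocol rumor crash.
Proof.
split=> [i nc|i K|j cj nsend i K|j [Kj]].
- by have [K hK] := not_crashes_halted nc; exists K, horizon.
- by case/decides_ghost=> _ -> p /rumors_sound[].
- case/decides_ghost=> ali ->; apply/negP => /rumors_sound[_ /= []].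
    by move=> ji; move: (crashes_ghost cj); rewrite ji ali.
  by case=> r [k [lt_r hk]]; move: (nsend r k); rewrite sendsE lt_r hk.
- case/decides_ghost=> alj _ i K /decides_ghost[ali ->].
  (* The certificate of [i] from the second run involves a core member, whose rumors at [midtime]
     include that of [j]. *)
  have sv : true \in served (ghost horizon i).
    apply: served_mono (served_by_last true ali); rewrite leq_mul2r; lia.
  have [q qQ /late_fact[_ sub]] := certified_core (served_certified sv).
  exact/sub/core_knows.
Qed.

End Correctness.

Section Counting.
Hypotheses (G_deg : forall i j, #|[set p | G i j p]| <= 12 * 2 ^ i)
  (G_miss : forall i, 2 ^ i * #|[set j | [forall p in Q, ~~ G i j p]]|
                        <= m + 2 * (n %/ 2 ^ (2 ^ i)) + 2).

(** A node with a neighbour in [Q] at the previous level is served by now, so only nodes missing [Q]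
    there still ask. *)
Lemma ask_traffic s i : s < 2 -> i < lv ->
  traffic ((s * lv + i) * period) <= ask_bound i.
Proof.
move=> lt_s lt_i; set f := s * lv + i; pose b := lv <= f.
have fi : f %% lv = i by rewrite modnMDl modn_small.
pose U := [set j | alive (f * period) j && (b \notin served (ghost (f * period) j))].
have leU : traffic (f * period) <= #|U| * (12 * 2 ^ i).
  rewrite -sum_nat_const /traffic -sum1_card.
  rewrite (eq_bigl (fun p : 'I_n * 'I_n => true && hears (f * period) p.1 p.2)); last first.
    by move=> p; rewrite inE.
  rewrite -(pair_big_dep xpredT (fun u v => hears (f * period) u v) (fun _ _ => 1)) /=.
  rewrite [leqRHS]big_mkcond; apply: leq_sum => j _; rewrite sum1_card.
  case: ifP => [_|jU].
    apply: leq_trans (G_deg i j); apply: subset_leq_card; apply/subsetP => p.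
    by rewrite !inE => /hearsP[_ _ _]; rewrite addresses_ask fi => /andP[].
  rewrite leqn0; apply/eqP; apply: eq_card0 => p; apply/negP => /hearsP[alj _ _].
  by rewrite addresses_ask => /andP[nsv _]; move: jU; rewrite inE alj nsv.
apply: leq_trans leU _; rewrite /ask_bound; case: i => [|i] in lt_i f b fi U *.
  by rewrite muln1 mulnC leq_mul2l /= -[n in leqRHS]card_ord max_card.
have UsX : U \subset [set j | [forall p in Q, ~~ G i j p]].
  apply/subsetP => j; rewrite !inE => /andP[alj nsv]; apply/forallP => p.
  apply/implyP => pQ; apply: contra nsv => Gjp.
  have fE : f = (s * lv + i).+1 by rewrite /f addnS.
  (* The previous phase lies in the same stage, since [i.+1 < lv]. *)
  have -> : b = (lv <= s * lv + i).
    by rewrite /b fE; case: (s) lt_s => [|[|]] // _; lia.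
  rewrite fE; apply: (phase_served pQ); last by rewrite modnMDl modn_small // ltnW.
  by apply: alive_le alj; rewrite fE mulSn /period; lia.
have := leq_trans (leq_mul (leqnn (2 ^ i)) (subset_leq_card UsX)) (G_miss i).
rewrite expnS; move: (2 ^ i) (m + _ + _) => z y; nia.
Qed.

(** The factor 4 stands for two runs with requests and acknowledgements in each. *)
Lemma messages_bound T : messages_sent gossip_protocol rumor crash T <=
  4 * \sum_(0 <= i < lv) ask_bound i
  + 2 * lv * (2 * D * #|[set p : 'I_n * 'I_n | E p.1 p.2]|).
Proof.
apply: leq_trans (messages_sent_traffic T) _; rewrite /horizon.
have blocks g k (p : nat) : \sum_(0 <= r < k * p) g r =
    \sum_(0 <= f < k) \sum_(0 <= o < p) g (f * p + o).
  elim: k => [|k IHk]; first by rewrite mul0n !big_nil.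
  rewrite mulSnr big_nat_recr //= -IHk (@big_cat_nat _ _ _ (k * p)) ?leq_addr //=.
  congr (_ + _); rewrite -{1}[k * p]add0n big_addn addKn.
  by apply: eq_bigr => o _; rewrite addnC.
rewrite blocks; apply: leq_trans.
  by apply: leq_sum_nat => f _; apply: phase_traffic.
rewrite big_split /= sum_nat_const_nat subn0 leq_add2r -big_distrr /=.
rewrite blocks (_ : 4 = 2 * 2) // -mulnA leq_mul2l /=.
have := sum_nat_const_nat 0 2 (\sum_(0 <= i < lv) ask_bound i).
rewrite subn0 => <-.
apply: leq_sum_nat => s /andP[_ lt_s].
by apply: leq_sum_nat => i /andP[_ lt_i]; apply: ask_traffic.
Qed.

End Counting.
End WithCore.
End GossipProtocol.

(** * Choice of the parameters *)

Import Order.TTheory GRing.Theory Num.Theory.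

(** The crashes hit less than a fifth of these nodes, which exist because [5 * t < n]. *)
Definition little t := 5 * t + 1.
Definition diam t := (2 * (trunc_log 2 (little t)).+1).+1.
Definition levels n := trunc_log 2 n + 5.

(** The graphs are fixed before the set [F] of crashing nodes; only the core depends on [F]. *)
Definition gossip_graphs (n t : nat) (g : rel 'I_n * (nat -> rel 'I_n)) : Prop :=
  [/\ #|[set p : 'I_n * 'I_n | g.1 p.1 p.2]| <= 1152 * little t,
      forall i j, #|[set p | g.2 i j p]| <= 12 * 2 ^ i
    & forall F : {set 'I_n}, #|F| <= t -> exists Q : {set 'I_n},
        [/\ forall q, q \in Q -> q < little t,
            [disjoint Q & F], little t < 2 * #|Q|,
            forall p q, p \in Q -> q \in Q ->
              q \in iter (diam t) (grow g.1 Q) [set p]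
          & forall i, 2 ^ i * #|[set j | [forall p in Q, ~~ g.2 i j p]]|
                        <= little t + 2 * (n %/ 2 ^ (2 ^ i)) + 2]].

Lemma gossip_graphs_exist n t : 5 * t < n -> exists g, gossip_graphs (n := n) t g.
Proof.
move=> lt_tn; pose L := [set i : 'I_n | i < little t].
have le_mn : little t <= n by rewrite /little addn1.
have cL : #|L| = little t by rewrite card_ltn_ord; apply/minn_idPr.
have L_gt0 : 0 < #|L| by rewrite cL /little addn1.
have [E [symE cE expE]] := expander_exists L_gt0.
have /choice[G GP] i := sampler_rel_exists setT (2 ^ i) L_gt0.
exists (E, G); split=> [|i j|F leF] /=; first by rewrite -cL.
  by case: (GP i) => _ + _; apply.
have few : 5 * #|F| <= #|L| by rewrite cL /little; lia.
have [Q [QL QF Qm Qd]] := core_exists symE L_gt0 few expE.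
have hit : #|L| <= 8 * #|Q| by move: #|L| #|Q| Qm => a c; lia.
rewrite cL in Qm Qd; exists Q; split=> // [q /(subsetP QL)|i].
- by rewrite inE.
- case: (GP i) => _ _ /(_ Q QL hit); rewrite cL cardsT card_ord.
  set X := [set u in _ | _]; set Y := [set j | _].
  by rewrite (_ : X = Y) //; apply/setP => j; rewrite !inE.
Qed.

(** A choice common to all nodes makes the protocol deterministic; the empty graphs are a default
    outside the range of [t]. *)
Lemma gossip_graphs_choice n t : {g | 5 * t < n -> gossip_graphs (n := n) t g}.
Proof.
apply: cid; have [/gossip_graphs_exist[g hg]|_] := boolP (5 * t < n).
  by exists g.
by exists (fun _ _ => false, fun _ _ _ => false).
Qed.

Definition gossip_solution : gossip_algorithm := fun n t V =>
  let g := sval (gossip_graphs_choice n t) in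
  gossip_protocol (little t) (diam t) (levels n) g.1 g.2 V.

Definition duration n t := levels n * period (diam t).

Lemma periodE t : period (diam t) = 4 * trunc_log 2 (little t) + 8.
Proof. by rewrite /period /diam; lia. Qed.

(** At this level [2 ^ (levels n - 2)] exceeds [4 * n], so the quotient vanishes and a single
    missing node would break the bound. *)
Lemma last_level_hits n t (Q : {set 'I_n}) (G : rel 'I_n) : 5 * t < n ->
  2 ^ (levels n - 2) * #|[set j | [forall p in Q, ~~ G j p]]|
    <= little t + 2 * (n %/ 2 ^ (2 ^ (levels n - 2))) + 2 ->
  forall j, exists2 p, p \in Q & G j p.
Proof.
move=> lt_tn; have -> : levels n - 2 = (trunc_log 2 n).+1 + 2 by rewrite /levels; lia.
set l := 2 ^ _; have big : 4 * n < l.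
  by rewrite /l expnD mulnC ltn_pmul2r // trunc_log_ltn.
rewrite divn_small; last first.
  by apply: leq_trans (ltn_expl l (isT : 1 < 2)); lia.
have n_gt0 : 0 < n by lia.
set X := [set j | _] => le_lX; have X0 : #|X| = 0.
  move: le_lX big lt_tn; rewrite /little; move: #|X| l => x l0; nia.
move=> j; have : j \notin X by rewrite (cards0_eq X0) inE.
rewrite inE negb_forall => /existsP[p]; rewrite negb_imply negbK => /andP[pQ Gjp].
by exists p.
Qed.

Lemma gossip_solution_spec n t (V : choiceType) (rumor : 'I_n -> V)
    (crash : crash_schedule n) : 5 * t < n -> at_most_crashes t crash ->
  [/\ gossiping (gossip_solution n t V) rumor crash,
      forall i, ~ node_crashes (gossip_solution n t V) rumor crash i ->
        halted_by (gossip_solution n t V) rumor crash (2 * duration n t) i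
    & forall T, messages_sent (gossip_solution n t V) rumor crash T <=
        4 * (60 * n + 24 * levels n * (little t + 2))
        + 2 * levels n * (2 * diam t * (1152 * little t))].
Proof.
move=> lt_tn few; rewrite /gossip_solution.
case: gossip_graphs_choice => g /= /(_ lt_tn)[cE Gdeg core].
have [Q [Qlow QF Qmaj Qdiam Qmiss]] := core _ few.
have Qcorrect q : q \in Q -> crash q = None.
  by move=> /(disjointFr QF); rewrite inE; case: (crash q).
split=> [|i|T].
- apply: (gossip_correct rumor Qlow Qcorrect Qmaj Qdiam); first by rewrite /levels; lia.
  exact: last_level_hits (Qmiss _).
- by move/not_crashes_halted; rewrite /horizon /duration mulnA.
- apply: leq_trans (messages_bound _ _ Qlow Qcorrect Qmaj Qdiam Gdeg Qmiss T) _.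
  apply: leq_add; last by rewrite !leq_mul2l cE !orbT.
  by rewrite leq_mul2l sum_ask_bound.
Qed.

Lemma solution_messages_le n t : 5 * t < n ->
  4 * (60 * n + 24 * levels n * (little t + 2))
    + 2 * levels n * (2 * diam t * (1152 * little t))
  <= 240 * n + 2400 * (144 * n + 8 * (t * duration n t)).
Proof.
move=> lt_tn; set P := duration n t; set w := 5 * t + 3.
have le1 : levels n * (little t + 2) <= P * w.
  by apply: leq_mul; [rewrite leq_pmulr|rewrite /little /w; lia].
have le2 : levels n * (2 * diam t) * little t <= P * w.
  by apply: leq_mul; [rewrite leq_mul2l /period; lia|rewrite /little /w; lia].
have le3 : P * w <= 144 * n + 8 * (t * P).
  (* For [t = 0] the term in [t] vanishes; the duration is then [8 * levels n <= 48 * n] and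
     [w = 3], whence 144. *)
  case: (posnP t) => [t0|t_gt0]; last by rewrite /w; move: (P) => p; nia.
  have -> : P = levels n * 8 by rewrite /P /duration periodE /little t0.
  have le_lv : levels n <= 6 * n.
    rewrite /levels; have := ltnW (ltn_expl (trunc_log 2 n) (isT : 1 < 2)).
    by have := @trunc_logP 2 n isT; lia.
  by rewrite /w t0; lia.
apply: (@leq_trans (240 * n + 2400 * (P * w))); last by lia.
have -> : 2 * levels n * (2 * diam t * (1152 * little t)) =
  2304 * (levels n * (2 * diam t) * little t) by nia.
move: le1 le2; move: (P * w) (levels n * _ * _) => pw z1.
rewrite -mulnA; move: (levels n * _) => z2; lia.
Qed.

Lemma trunc_log_little t : trunc_log 2 (little t) <= trunc_log 2 t + 3.
Proof.
case: (posnP t) => [->|t_gt0]; first by [].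
rewrite -ltnS -(ltn_exp2l _ _ (isT : 1 < 2)).
have : little t <= 8 * t by rewrite /little; lia.
have := @trunc_logP 2 (little t) isT; rewrite {1}/little addn1 => /(_ isT).
have := @trunc_log_ltn 2 t isT.
by rewrite -addSn expnD; move: (2 ^ _) (2 ^ _) => a c; lia.
Qed.

Local Open Scope ring_scope.

(** * Passage to real bounds *)

Lemma absorb_constants (R : realFieldType) (a b c d u k x y z : R) :
  0 <= a -> 0 <= b -> 0 <= c -> 0 <= d -> 0 <= u -> 0 <= k -> 0 <= x -> 0 <= z ->
  u * y <= u * (k * z) ->
  a * x + u * (b * x + c * y) <= (a + u * b + u * (c * k) + d * k) * (x + z).
Proof.
move=> a0 b0 c0 d0 u0 k0 x0 z0 le_yz.
have -> : (a + u * b + u * (c * k) + d * k) * (x + z) =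
    a * x + u * (b * x) + c * (u * (k * z)) +
    (a * z + u * b * z + d * k * z + u * (c * k) * x + d * k * x) by ring.
rewrite mulrDr addrA -[leLHS]addr0 lerD //; last by rewrite !addr_ge0 ?mulr_ge0.
by rewrite lerD2l mulrCA ler_wpM2l.
Qed.

Section Logarithms.
Variable R : realType.

Lemma log1_ge1 n : 1 <= log1 R n.
Proof. by rewrite /log1 le_max lexx. Qed.

Lemma trunc_log_le_log1 n : (trunc_log 2 n)%:R <= (ln 2%:R)^-1 * log1 R n.
Proof.
have ln2 : 0 < ln (2%:R : R) by rewrite ln_gt0 // ltr1n.
have [->|n_gt0] := posnP n.
  by rewrite trunc_log0 mulr_ge0 ?invr_ge0 ?(ltW ln2) // (le_trans ler01) ?log1_ge1.
rewrite mulrC ler_pdivlMr //; apply: (@le_trans _ _ (ln n%:R)); last first.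
  by rewrite /log1 le_max lexx orbT.
rewrite mulr_natl -lnXn ?ltr0n // -natrX ler_ln ?posrE ?ltr0n ?expn_gt0 //.
by rewrite ler_nat trunc_logP.
Qed.

(** The first factor bounds [levels n] and the second bounds the period,
    [4 * (trunc_log 2 t + 3) + 8] at most. *)
Definition log_const : R := ((ln 2%:R)^-1 + 5) * (4 * (ln 2%:R)^-1 + 20).

Lemma duration_le n t :
  (duration n t)%:R <= log_const * (log1 R n * log1 R t).
Proof.
have k_ge0 : 0 <= (ln (2%:R : R))^-1 by rewrite invr_ge0 ln_ge0 // ler1n.
rewrite /duration natrM mulrACA; apply: ler_pM; rewrite ?ler0n //.
  rewrite /levels natrD mulrDl lerD ?trunc_log_le_log1 //.
  by rewrite ler_peMr ?log1_ge1.
rewrite periodE; apply: (@le_trans _ _ (4 * trunc_log 2 t + 20)%:R).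
  by rewrite ler_nat; have := trunc_log_little t; lia.
rewrite natrD natrM [leRHS]mulrDl -mulrA lerD //.
  by rewrite ler_pM2l ?trunc_log_le_log1.
by rewrite ler_peMr ?log1_ge1.
Qed.

Lemma log_const_ge0 : 0 <= log_const.
Proof.
have k_ge0 : 0 <= (ln (2%:R : R))^-1 by rewrite invr_ge0 ln_ge0 // ler1n.
by rewrite mulr_ge0 // addr_ge0 // mulr_ge0.
Qed.

End Logarithms.

Theorem theorem9 (R : realType) :
  exists (A : gossip_algorithm) (C : R),
    forall (n t : nat) (V : choiceType), (5 * t < n)%N ->
      [/\ solves_gossiping t (A n t V),
          running_time_le t (A n t V) (C * (log1 R n * log1 R t))
        & messages_le t (A n t V) (C * (n%:R + t%:R * log1 R n * log1 R t))].
Proof.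
have [k k_ge0 kP] : exists2 k : R, 0 <= k &
    forall n t, (duration n t)%:R <= k * (log1 R n * log1 R t).
  by exists (log_const R); [apply: log_const_ge0|apply: duration_le].
pose u : R := 2400%:R; have u_ge0 : 0 <= u by rewrite ler0n.
(* The last summand pays for the running time, the others for the messages. *)
exists gossip_solution, (240%:R + u * 144%:R + u * (8%:R * k) + 2%:R * k).
move=> n t V lt_tn; set C := (X in X * _).
have log_ge0 : 0 <= log1 R n * log1 R t.
  by rewrite mulr_ge0 // (le_trans ler01) ?log1_ge1.
have dur := kP n t.
split=> [rumor crash few|rumor crash few|rumor crash few T].
- by case: (gossip_solution_spec rumor lt_tn few).
- exists (2 * duration n t)%N; split; last by case: (gossip_solution_spec rumor lt_tn few).
  apply: (@le_trans _ _ (2%:R * k * (log1 R n * log1 R t))).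
    by rewrite natrM -mulrA ler_pM2l.
  rewrite ler_wpM2r // /C lerDr !addr_ge0 ?mulr_ge0 //.
- have [_ _ /(_ T) sent] := gossip_solution_spec rumor lt_tn few.
  have := leq_trans sent (solution_messages_le lt_tn); rewrite -(ler_nat R) => /le_trans.
  apply; rewrite natrD !natrM natrD !natrM -/u -mulrA.
  have t_ge0 : 0 <= t%:R :> R := ler0n _ _.
  have n_ge0 : 0 <= n%:R :> R := ler0n _ _.
  have := ler_wpM2l u_ge0 (ler_wpM2l t_ge0 dur); rewrite (mulrCA t%:R k).
  have := mulr_ge0 t_ge0 log_ge0.
  by rewrite /C => z_ge0 le_yz; apply: absorb_constants; rewrite ?ler0n // -natrM.
Qed.
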